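(* Let $A$ be a commutative approximately unital Banach algebra. The closed ideals in $A$ having a bounded approximate identity in ${\mathfrak r}_A$ (respectively, in ${\mathfrak F}_A$) are precisely the ideals of the form $\overline{EA}$ for some subset $E\subset{\mathfrak F}_A$ (respectively, $E\subset{\mathfrak r}_A$). They are also precisely the closures of unions of increasing (upward directed) families of ideals of the form $\overline{xA}$ with $x\in{\mathfrak F}_A$ (respectively, $x\in{\mathfrak r}_A$).
   Context: Banach algebras are complex with submultiplicative norm; ''unital'' means identity of norm 1. Approximately unital: has a contractive approximate identity. Multiplier unitization $A^1$: $A$ if unital, otherwise $A+\mathbb{C}1$ with $\|a+\lambda1\|=\sup\{\|ac+\lambda c\|:c\in A,\|c\|\le1\}$. ${\mathfrak F}_A=\{a\in A:\|1-a\|_{A^1}\le1\}$; ${\mathfrak r}_A=\{a\in A:\mathrm{Re}\,\varphi(a)\ge0$ for all $\varphi\in(A^1)^*$ with $\|\varphi\|=\varphi(1)=1\}$. A bounded approximate identity (bai) is a bounded net $(e_t)$ with $e_ta\to a$ for all $a$ in the ideal. $\overline{EA}$ denotes the closed linear span of $\{xa:x\in E,a\in A\}$. *)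

(* Defs.v *)
From HB Require Import structures.
From mathcomp Require Import all_boot all_order all_algebra.
From mathcomp Require Import all_classical all_reals all_analysis.
From mathcomp Require Import complex.
Set Implicit Arguments. Unset Strict Implicit. Unset Printing Implicit Defensive.
Import Order.TTheory GRing.Theory Num.Theory.
Import numFieldNormedType.Exports.
Local Open Scope classical_set_scope.
Local Open Scope ring_scope.

Section BanachAlgebra.
Variable R : realType.
Local Notation C := (R[i]).

Record banach_alg (V : completeNormedModType C) := BanachAlg {
  bmul : V -> V -> V;
  bmulDl : forall (k : C) (x y z : V), bmul (k *: x + y) z = k *: bmul x z + bmul y z;
  bmulDr : forall (k : C) (x y z : V), bmul z (k *: x + y) = k *: bmul z x + bmul z y;
  bmulA : forall x y z : V, bmul x (bmul y z) = bmul (bmul x y) z;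
  bmul_norm : forall x y : V, `|bmul x y| <= `|x| * `|y|
}.

Variable V : completeNormedModType C.
Variable A : banach_alg V.
Local Notation "x ** y" := (bmul A x y) (at level 40).

Definition commutative_alg := forall x y : V, x ** y = y ** x.

Record directed_set (I : Type) := DirectedSet {
  dle : I -> I -> Prop;
  dle_refl : forall i, dle i i;
  dle_trans : forall i j k, dle i j -> dle j k -> dle i k;
  dle_ub : forall i j, exists k, dle i k /\ dle j k;
  dinhabited : exists i : I, True
}.

Definition net_to (I : Type) (D : directed_set I) (u : I -> V) (l : V) :=
  forall eps : C, 0 < eps -> exists t0, forall t, dle D t0 t -> `|u t - l| < eps.

Definition approx_unital :=
  exists (I : Type) (D : directed_set I) (e : I -> V),
    (forall t, `|e t| <= 1) /\
    (forall a, net_to D (fun t => e t ** a) a /\ net_to D (fun t => a ** e t) a).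

Definition is_identity (e : V) := (forall x, e ** x = x /\ x ** e = x) /\ `|e| = 1.
Definition unital := exists e, is_identity e.

(* [unitz_norm_le a l r] : ||a + l 1||_{A^1} <= r, where A^1 = A if A is
   unital and otherwise A + C1 with the multiplier norm. *)
Definition unitz_norm_le (a : V) (l : C) (r : C) :=
  (unital -> forall e, is_identity e -> `|a + l *: e| <= r) /\
  (~ unital -> forall c : V, `|c| <= 1 -> `|a ** c + l *: c| <= r).

Definition frakF : set V := [set a | unitz_norm_le (- a) 1 1].

(* states of A^1: phi(a + l 1) = psi a + l * phi(1), phi(1) = 1, ||phi|| <= 1 *)
Definition unitz_state (psi : V -> C) :=
  (forall (k : C) (x y : V), psi (k *: x + y) = k * psi x + psi y) /\
  (forall a l r, unitz_norm_le a l r -> `|psi a + l| <= r).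

Definition frakr : set V :=
  [set a | forall psi, unitz_state psi -> 0 <= 'Re (psi a)].

Definition lin_span (S : set V) : set V :=
  [set v | exists n (c : 'I_n -> C) (s : 'I_n -> V),
      (forall i, S (s i)) /\ v = \sum_(i < n) c i *: s i].

Definition is_closed_ideal (J : set V) :=
  J 0 /\ (forall (k : C) x y, J x -> J y -> J (k *: x + y)) /\
  (forall x a, J a -> J (x ** a) /\ J (a ** x)) /\ closed J.

Definition has_bai_in (J S : set V) :=
  exists (I : Type) (D : directed_set I) (e : I -> V),
    (forall t, J (e t) /\ S (e t)) /\
    (exists M : C, forall t, `|e t| <= M) /\
    (forall a, J a -> net_to D (fun t => e t ** a) a).

Definition clEA (E : set V) : set V :=
  closure (lin_span [set v | exists x a, E x /\ v = x ** a]).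

Definition directed_union_of (J S : set V) :=
  exists X : set V, X `<=` S /\ (exists x, X x) /\
    (forall x y, X x -> X y -> exists z, X z /\
         clEA [set x] `<=` clEA [set z] /\ clEA [set y] `<=` clEA [set z]) /\
    J = closure (\bigcup_(x in X) clEA [set x]).

End BanachAlgebra.

(* Main.v *)
Require Import Defs.
From HB Require Import structures.
From mathcomp Require Import all_boot all_order all_algebra.
From mathcomp Require Import all_classical all_reals all_analysis.
From mathcomp Require Import complex ring lra.
Import Order.TTheory GRing.Theory Num.Theory.
Import numFieldNormedType.Exports.
Local Open Scope classical_set_scope.
Local Open Scope ring_scope.

(** Write U = 1 - x for x in F_A: this is a contraction for the action of A^1
    on A.  For commuting contractions U and W, the products
    (U - W) ((U + W) / 2)^n tend to 0 in norm.  Taking W = 1, the elements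
    e = 1 - (1 - x / 2)^n of F_A lie in the closure of xA and satisfy
    e x -> x; finite products of the corresponding contractions 1 - e yield a
    bounded approximate identity for the closure of EA.  Taking W = 1 - y and
    z = (x + y) / 2, modulo the closure of zA one has (U + W) / 2 = 1, so
    x - y, and hence x and y, belong to that closure: this gives directedness.
    Finally, if x is in r_A, then states built from norming functionals show
    that t + x is bounded below by t for all t > 0, so 1 + x is invertible
    and y = x (1 + x)^-1 is an element of F_A with yA = xA. *)

(** * Real-valued norm and closed subspaces *)

Section RealNorm.
Set Implicit Arguments.
Unset Strict Implicit.
Variables (R : realType) (V : completeNormedModType R[i]).
Implicit Types (u v w : V) (S : set V).

Definition nm v : R := complex.Re `|v|.

Lemma nmE v : `|v| = (nm v)%:C%C.
Proof. exact/esym/RRe_real/normr_real. Qed.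

Lemma nm_ge0 v : 0 <= nm v.
Proof. by rewrite -lecR -nmE; exact: normr_ge0. Qed.

Lemma nm0 : nm (0 : V) = 0.
Proof. by rewrite /nm normr0. Qed.

Lemma nm_eq0 v : nm v = 0 -> v = 0.
Proof. by move=> v0; apply/normr0_eq0; rewrite nmE v0. Qed.

Lemma nmD u v : nm (u + v) <= nm u + nm v.
Proof. by rewrite -lecR rmorphD /= -!nmE; exact: ler_normD. Qed.

Lemma nmN v : nm (- v) = nm v.
Proof. by rewrite /nm normrN. Qed.

Lemma nmB u v : nm (u - v) <= nm u + nm v.
Proof. by rewrite -(nmN v) nmD. Qed.

Lemma nmBC u v : nm (u - v) = nm (v - u).
Proof. by rewrite -nmN opprB. Qed.

Lemma nmZ (k : R[i]) v : nm (k *: v) = complex.Re `|k| * nm v.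
Proof.
apply: complexI; rewrite rmorphM /= (RRe_real (normr_real k)).
by rewrite -!nmE normrZ.
Qed.

Lemma Re_normC (t : R) : complex.Re `|t%:C%C : R[i]| = `|t|.
Proof. by rewrite normc_def /= expr0n addr0 sqrtr_sqr. Qed.

Lemma Re_norm_ge0 (k : R[i]) : 0 <= complex.Re `|k|.
Proof. by rewrite -lecR (RRe_real (normr_real k)); exact: normr_ge0. Qed.

Lemma nmZr (t : R) v : nm (t%:C%C *: v) = `|t| * nm v.
Proof. by rewrite nmZ Re_normC. Qed.

Lemma pos_complexP (e : R[i]) : 0 < e -> exists2 r : R, 0 < r & e = r%:C%C.
Proof.
move=> e0; have eE : e = (complex.Re e)%:C%C by rewrite RRe_real// gtr0_real.
by exists (complex.Re e) => //; rewrite -ltcR -eE.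
Qed.

Lemma closureP S v :
  closure S v <-> forall e : R, 0 < e -> exists2 u, S u & nm (v - u) < e.
Proof.
split=> [clS e e0|clS B].
  have e0C : 0 < (e%:C)%C :> R[i] by rewrite ltcR.
  have [u [Su /=]] := clS _ (nbhsx_ballx v _ e0C).
  by rewrite -ball_normE /= nmE ltcR => uv; exists u.
move=> /nbhs_ballP[_ /= /pos_complexP[e e0 ->] vB].
have [u Su vu] := clS e e0; exists u; split=> //.
by apply: vB; rewrite -ball_normE /= nmE ltcR.
Qed.

Lemma closedP S : closed S <->
  forall v, (forall e : R, 0 < e -> exists2 u, S u & nm (v - u) < e) -> S v.
Proof.
split=> [clS v /closureP|clS v /closureP]; [exact: clS|exact: clS].
Qed.

Definition closed_subspace S :=
  [/\ S 0, forall (k : R[i]) u v, S u -> S v -> S (k *: u + v) & closed S].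

Lemma closed_subspaceD S u v : closed_subspace S -> S u -> S v -> S (u + v).
Proof. by move=> [_ SD _] Su Sv; rewrite -(scale1r u); exact: SD. Qed.

Lemma closed_subspaceZ S k u : closed_subspace S -> S u -> S (k *: u).
Proof. by move=> [S0 SD _] Su; rewrite -(addr0 (_ *: _)); exact: SD. Qed.

Lemma closed_subspaceB S u v : closed_subspace S -> S u -> S v -> S (u - v).
Proof.
move=> cS Su Sv; rewrite -scaleN1r; apply: closed_subspaceD => //.
exact: closed_subspaceZ.
Qed.

Lemma closed_subspace_sum S n (f : 'I_n -> V) :
  closed_subspace S -> (forall i, S (f i)) -> S (\sum_(i < n) f i).
Proof.
move=> cS Sf; elim/big_ind: _ => // [|x y]; first by case: cS.
exact: closed_subspaceD.
Qed.

Lemma exp_half_lt (e : R) : 0 < e -> exists n, 2^-1 ^+ n < e.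
Proof.
move=> e0; have h1 : `|2^-1 : R| < 1 by rewrite ger0_norm; lra.
have /cvgrPdist_lt/(_ e e0)[n _ /(_ n (leqnn n))] := @cvg_expr R _ h1.
by rewrite /= sub0r normrN ger0_norm ?exprn_ge0 ?invr_ge0// => ?; exists n.
Qed.

(** The Picard iterates from 0 are Cauchy. This is the only completeness argument; it serves to
    solve the resolvent equation. *)
Lemma half_contraction_fixpoint (f : V -> V) :
  (forall u v, nm (f u - f v) <= 2^-1 * nm (u - v)) -> exists v, v = f v.
Proof.
move=> ctr; pose y n := iter n f 0; pose D := nm (f 0).
have D0 : 0 <= D by exact: nm_ge0.
have step n : nm (y n.+1 - y n) <= 2^-1 ^+ n * D.
  elim: n => [|n IH]; first by rewrite /= subr0 expr0 mul1r.
  rewrite exprS -mulrA (le_trans (ctr (y n.+1) (y n)))//.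
  by rewrite ler_pM2l// invr_gt0.
(* The factor [1 - 2^-1 ^+ m] records the exact partial geometric sum, which lets the induction on
   [m] close. *)
have tail n m : nm (y (n + m)%N - y n) <= 2 * 2^-1 ^+ n * D * (1 - 2^-1 ^+ m).
  elim: m => [|m IH]; first by rewrite addn0 subrr nm0 expr0 subrr mulr0.
  have -> : y (n + m.+1)%N - y n =
      (y (n + m).+1 - y (n + m)%N) + (y (n + m)%N - y n).
    by rewrite addrA subrK addnS.
  rewrite (le_trans (nmD _ _))// (le_trans (lerD (step _) IH))// exprD exprS.
  by lra.
have tail_le n m : nm (y (n + m)%N - y n) <= 2 * 2^-1 ^+ n * D.
  apply: (le_trans (tail n m)); rewrite ler_piMr ?gerBl ?exprn_ge0 ?invr_ge0//.
  by rewrite !mulr_ge0 ?exprn_ge0 ?invr_ge0.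
have : cvg (y n @[n --> \oo]).
  apply/cauchy_cvgP/cauchy_exP => _ /pos_complexP[e e0 ->].
  have D1 : 0 < 2 * D + 1 by lra.
  have [n nP] := exp_half_lt (divr_gt0 e0 D1).
  exists (y n), n => // m /= nm_; rewrite -ball_normE /= nmE ltcR nmBC.
  rewrite -(subnKC nm_) (le_lt_trans (tail_le _ _))//.
  move: nP; rewrite ltr_pdivlMr// => nP; apply: le_lt_trans nP.
  have h0 : 0 <= 2^-1 ^+ n :> R by rewrite exprn_ge0 ?invr_ge0.
  by move: h0; lra.
move=> /cvg_ex[v /cvgrPdist_lt yv]; exists v; apply/subr0_eq/nm_eq0.
have near_v e : 0 < e -> \forall n \near \oo, nm (v - y n) < e.
  move=> e0; have e0C : 0 < (e%:C)%C :> R[i] by rewrite ltcR.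
  by apply: filterS (yv _ e0C) => n; rewrite nmE ltcR.
apply/eqP; rewrite eq_le nm_ge0 andbT; apply/ler_addgt0Pl => e e0; rewrite addr0.
have e2 : 0 < e / 2 by rewrite divr_gt0.
have [n _ nP] := near_v _ e2.
have -> : v - f v = (v - y n.+1) + (f (y n) - f v) by rewrite addrA subrK.
apply: (le_trans (nmD _ _)).
have := nP n (leqnn n); have := nP n.+1 (leqnSn n); have := ctr (y n) v.
by rewrite (nmBC (y n) v) /=; lra.
Qed.

End RealNorm.

(** * Norming functionals *)

Section NormingFunctional.
Set Implicit Arguments.
Unset Strict Implicit.
Variables (R : realType) (V : completeNormedModType R[i]).
Implicit Types (v w : V) (G : set (V * R)).

(* The last clause, rather than membership of [(c, nm c)], lets the empty set
   be a dominated graph, as Zorn's lemma needs it for the empty chain. *)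
Definition dominated_graph (c : V) G :=
  [/\ forall (t : R) p q, G p -> G q -> G (t%:C%C *: p.1 + q.1, t * p.2 + q.2),
      forall p, G p -> p.2 <= nm p.1 &
      forall p, G p -> G (c, nm c)].

(** One-dimensional step of the real Hahn-Banach theorem. The value at [v] is the least upper bound
    of the lower constraints [L]; subadditivity of the norm puts it below every upper constraint. *)
Lemma dominated_graph_extend c G v : dominated_graph c G -> G !=set0 ->
  exists2 G', dominated_graph c G' & G `<=` G' /\ exists r, G' (v, r).
Proof.
move=> [GD Gle Gc] [p0 Gp0].
have cG : G (c, nm c) := Gc _ Gp0.
have G0 : G (0, 0).
  have := GD (-1) _ _ cG cG.
  by rewrite rmorphN1 scaleN1r addNr mulN1r addNr.
have GZ (t : R) p : G p -> G (t%:C%C *: p.1, t * p.2).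
  by move=> /GD/(_ G0); move=> /(_ t); rewrite !addr0.
pose L := [set p.2 - nm (p.1 - v) | p in G].
have LU p q : G p -> G q -> p.2 - nm (p.1 - v) <= nm (q.1 + v) - q.2.
  move=> Gp Gq; have := Gle _ (GD 1 _ _ Gp Gq) => /=.
  rewrite rmorph1 scale1r mul1r.
  have -> : p.1 + q.1 = (p.1 - v) + (q.1 + v) by rewrite addrACA addNr addr0.
  by have := nmD (p.1 - v) (q.1 + v); lra.
have Lub q : G q -> ubound L (nm (q.1 + v) - q.2).
  by move=> Gq _ [p Gp <-]; exact: LU.
have L0 : L !=set0 by exists (p0.2 - nm (p0.1 - v)), p0.
pose a := sup L.
have aU q : G q -> a <= nm (q.1 + v) - q.2.
  by move=> Gq; apply: ge_sup => //; exact: Lub.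
have La p : G p -> p.2 - nm (p.1 - v) <= a.
  move=> Gp; apply: ub_le_sup; last by exists p.
  by exists (nm (p0.1 + v) - p0.2); exact: Lub.
exists [set p | exists t q, G q /\ p = (q.1 + t%:C%C *: v, q.2 + t * a)]; split.
- move=> s _ _ [t [p [Gp ->]]] [u [q [Gq ->]]] /=.
  exists (s * t + u), (s%:C%C *: p.1 + q.1, s * p.2 + q.2); split; first exact: GD.
  rewrite /= scalerDr !scalerA rmorphD rmorphM /= scalerDl addrACA.
  by congr (_, _); ring.
(* After scaling to coefficient -1 or 1, a negative [t] uses the lower constraints and a positive
   [t] the upper ones. *)
- move=> _ [t [q [Gq ->]]] /=; have [t0|t0|->] := ltrgtP t 0.
  + have := La _ (GZ (- t)^-1 _ Gq) => /=.
    rewrite -(ler_pM2l (x := - t)) ?oppr_gt0// mulrBr mulrA mulfV ?oppr_eq0 ?lt_eqF//.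
    have -> : - t * nm (((- t)^-1)%:C%C *: q.1 - v) = nm (q.1 + t%:C%C *: v).
      rewrite -[X in X * _](gtr0_norm (x := - t)) ?oppr_gt0//.
      rewrite -nmZr scalerBr scalerA -rmorphM.
      by rewrite mulfV ?oppr_eq0 ?lt_eqF// scale1r rmorphN scaleNr opprK.
    by lra.
  + have := aU _ (GZ t^-1 _ Gq) => /=.
    rewrite -(ler_pM2l t0) mulrBr mulrA mulfV ?gt_eqF//.
    have -> : t * nm ((t^-1)%:C%C *: q.1 + v) = nm (q.1 + t%:C%C *: v).
      rewrite -[X in X * _](gtr0_norm t0) -nmZr scalerDr scalerA -rmorphM.
      by rewrite mulfV ?gt_eqF// scale1r.
    by lra.
  + by rewrite rmorph0 scale0r mul0r !addr0; exact: Gle.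
- move=> _ _; exists 0, (c, nm c); split => //.
  by rewrite rmorph0 scale0r mul0r !addr0.
- move=> p Gp; exists 0, p; split=> //; rewrite rmorph0 scale0r mul0r !addr0.
  by case: p {Gp}.
- by exists a, 1, (0, 0); split=> //=; rewrite rmorph1 scale1r mul1r !add0r.
Qed.

(** A maximal dominated graph is total by the extension step and single-valued by domination, hence
    is the graph of the functional. *)
Lemma real_norming_functional c : exists f : V -> R,
  [/\ forall (t : R) v w, f (t%:C%C *: v + w) = t * f v + f w,
      forall v, f v <= nm v & f c = nm c].
Proof.
have [|G [dG maxG]] := @Zorn_bigcup _ (dominated_graph c).
  move=> F FP Ftot; split.
  - move=> t p q [X FX Xp] [Y FY Yq].
    have [XY|YX] := Ftot _ _ FX FY.
      by exists Y => //; have [+ _ _] := FP _ FY; apply=> //; exact: XY.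
    by exists X => //; have [+ _ _] := FP _ FX; apply=> //; exact: YX.
  - by move=> p [X FX Xp]; have [_ + _] := FP _ FX; apply.
  - by move=> p [X FX Xp]; exists X => //; have [_ _ +] := FP _ FX; apply; exact: Xp.
have G0 : G !=set0.
  apply/set0P/eqP => G0.
  (* The real line through [c] is a dominated graph strictly above the empty one. *)
  apply: (maxG [set p | exists t : R, p = (t%:C%C *: c, t * nm c)]).
    rewrite G0; split=> [? []|/(_ (c, nm c))]; apply.
    by exists 1; rewrite rmorph1 scale1r mul1r.
  split.
  - move=> t _ _ [s ->] [u ->]; exists (t * s + u) => /=.
    by rewrite scalerA rmorphD rmorphM scalerDl mulrDl mulrA.
  - by move=> _ [t ->] /=; rewrite nmZr ler_wpM2r ?nm_ge0// ler_norm.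
  - by move=> _ _; exists 1; rewrite rmorph1 scale1r mul1r.
have Gtot v : exists r, G (v, r).
  have [G' dG' [GG' [r Gr]]] := dominated_graph_extend v dG G0.
  have [G'G|nG'G] := pselect (G' `<=` G); first by exists r; exact: G'G.
  by case: (maxG G' (conj GG' nG'G)).
have [f fG] := choice Gtot; exists f; case: dG => GD Gle Gc.
(* Subtracting two pairs over [v] puts [(0, r - s)] in [G], and domination gives
   [r - s <= nm 0 = 0]. *)
have Guniq v r s : G (v, r) -> G (v, s) -> r = s.
  have le r' s' : G (v, r') -> G (v, s') -> r' <= s'.
    move=> Gr Gs; have /Gle /= := GD (-1) _ _ Gs Gr.
    by rewrite rmorphN1 scaleN1r addNr nm0; lra.
  by move=> Gr Gs; apply/eqP; rewrite eq_le !le.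
split=> [t v w|v|].
- by apply: Guniq (fG _) _; exact: (GD t _ _ (fG v) (fG w)).
- exact: Gle (fG v).
- by apply: Guniq (fG _) _; exact: Gc (fG c).
Qed.

(** Complexification of the real functional: [phi v = f v - i f (i v)] is complex linear with real
    part [f]. *)
Lemma norming_functional c : exists phi : V -> R[i],
  [/\ forall (k : R[i]) v w, phi (k *: v + w) = k * phi v + phi w,
      forall v, `|phi v| <= `|v| & phi c = `|c|].
Proof.
have [f [flin fle fc]] := real_norming_functional c.
have f0 : f 0 = 0.
  by have := flin 1 0 0; rewrite scaler0 addr0 mul1r; lra.
have fD v w : f (v + w) = f v + f w.
  by have := flin 1 v w; rewrite rmorph1 scale1r mul1r.
have fZ (t : R) v : f (t%:C%C *: v) = t * f v.
  by have := flin t v 0; rewrite !addr0 f0 addr0.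
pose phi v := (f v +i* - f ('i%C *: v))%C.
have philin (k : R[i]) v w : phi (k *: v + w) = k * phi v + phi w.
  rewrite /phi; case: k => a b.
  have kv : (a +i* b)%C *: v = a%:C%C *: v + b%:C%C *: ('i%C *: v).
    rewrite scalerA -scalerDl; congr (_ *: _); apply/eqP.
    by rewrite eq_complex /=; apply/andP; split; apply/eqP; ring.
  have ikv : 'i%C *: ((a +i* b)%C *: v) = a%:C%C *: ('i%C *: v) + (- b)%:C%C *: v.
    rewrite !scalerA -scalerDl; congr (_ *: _); apply/eqP.
    by rewrite eq_complex /=; apply/andP; split; apply/eqP; ring.
  rewrite scalerDr ikv kv !fD !fZ; apply/eqP; rewrite eq_complex /=.
  by apply/andP; split; apply/eqP; ring.
have phiRe v : complex.Re (phi v) = f v by [].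
have phile v : `|phi v| <= `|v|.
  have [->|phi0] := eqVneq (phi v) 0; first by rewrite normr0 normr_ge0.
  (* A unimodular factor that rotates [phi v] onto its modulus, so that the bound on the real part
     [f] applies. *)
  pose th := `|phi v| / phi v.
  have th1 : `|th| = 1 by rewrite normrM normfV normr_id mulfV// normr_eq0.
  have thE : phi (th *: v) = `|phi v|.
    by rewrite -[th *: v]addr0 philin /phi scaler0 f0 oppr0 addr0 -/(phi v) divfK.
  have := fle (th *: v); rewrite -phiRe thE -lecR -!nmE normrZ th1 mul1r.
  by rewrite (RRe_real (normr_real (phi v))).
exists phi; split=> //.
move: (phile c); rewrite !nmE normc_def lecR /phi /= fc => h.
apply/eqP; rewrite eq_complex /= eqxx /=.
(* The real part of [phi c] already equals [nm c], so the modulus bound leaves no room for an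
   imaginary part. *)
have : nm c ^+ 2 + (- f ('i%C *: c)) ^+ 2 <= nm c ^+ 2.
  rewrite -[leLHS]sqr_sqrtr ?addr_ge0 ?sqr_ge0//.
  by rewrite lerXn2r// nnegrE ?nm_ge0 ?sqrtr_ge0.
rewrite gerDl => h2; rewrite -sqrf_eq0 eq_le h2; exact: sqr_ge0.
Qed.
End NormingFunctional.

(** * The unitization and commuting contractions *)

Section Unitization.
Set Implicit Arguments.
Unset Strict Implicit.
Variables (R : realType) (V : completeNormedModType R[i]).
(* Used also for unital [A], where [act] is then not faithful; by
   [unitz_norm_leP] the norm of A^1 is the operator norm of [act] in both
   cases. *)
Definition unitization (A : banach_alg V) & commutative_alg A : Type :=
  (V * R[i]^o)%type.

Variables (A : banach_alg V) (cA : commutative_alg A).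
Local Notation "x ** y" := (bmul A x y) (at level 40).
Local Notation U := (unitization cA).

HB.instance Definition _ := GRing.Lmodule.on U.

Lemma bmul_addl x y z : (x + y) ** z = x ** z + y ** z.
Proof. by have := bmulDl A 1 x y z; rewrite !scale1r. Qed.
Lemma bmul_addr x y z : z ** (x + y) = z ** x + z ** y.
Proof. by have := bmulDr A 1 x y z; rewrite !scale1r. Qed.
Lemma bmul0l z : 0 ** z = 0.
Proof. by apply: (addrI (0 ** z)); rewrite -bmul_addl !addr0. Qed.
Lemma bmul0r z : z ** 0 = 0.
Proof. by rewrite cA bmul0l. Qed.
Lemma bmulZl k x z : (k *: x) ** z = k *: (x ** z).
Proof. by have := bmulDl A k x 0 z; rewrite bmul0l !addr0. Qed.
Lemma bmulZr k x z : z ** (k *: x) = k *: (z ** x).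
Proof. by rewrite cA bmulZl cA. Qed.
Lemma bmulBl x y z : (x - y) ** z = x ** z - y ** z.
Proof. by rewrite bmul_addl -scaleN1r bmulZl scaleN1r. Qed.
Lemma bmulBr x y z : z ** (x - y) = z ** x - z ** y.
Proof. by rewrite cA bmulBl ![_ ** z]cA. Qed.

Definition unitization_mul (p q : U) : U :=
  (p.1 ** q.1 + p.2 *: q.1 + q.2 *: p.1, p.2 * q.2).
Definition unitization_one : U := (0, 1).

Lemma unitization_mulC : commutative unitization_mul.
Proof.
move=> p q; rewrite /unitization_mul cA (mulrC p.2); congr (_, _).
by rewrite addrAC.
Qed.

Lemma unitization_mulA : associative unitization_mul.
Proof.
move=> p q r; rewrite /unitization_mul /= mulrA; congr (_, _).
rewrite !(bmul_addl, bmul_addr, bmulZl, bmulZr, scalerDr, scalerA, bmulA).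
rewrite (mulrC r.2 p.2) (mulrC r.2 q.2) !addrA.
by rewrite [RHS](ACl (1*3*5*2*4*6*7))/=.
Qed.

Lemma unitization_mul1 : left_id unitization_one unitization_mul.
Proof.
move=> [a l]; rewrite /unitization_mul /= bmul0l mul1r scale1r scaler0.
by rewrite add0r addr0.
Qed.

Lemma unitization_mulD : left_distributive unitization_mul +%R.
Proof.
move=> p q r; rewrite /unitization_mul /= mulrDl; congr (_, _).
rewrite bmul_addl scalerDl scalerDr !addrA /=.
by rewrite [RHS](ACl (1*4*2*5*3*6)).
Qed.

Lemma unitization_oner_neq0 : unitization_one != 0 :> U.
Proof. by apply/eqP => -[/eqP]; rewrite oner_eq0. Qed.

HB.instance Definition _ := GRing.Zmodule_isComNzRing.Build U
  unitization_mulA unitization_mulC unitization_mul1 unitization_mulD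
  unitization_oner_neq0.

Definition act (p : U) (c : V) : V := p.1 ** c + p.2 *: c.
Definition inj (a : V) : U := (a, 0).
Definition scal (t : R) : U := (0, t%:C%C).

Lemma act1 c : act 1 c = c.
Proof. by rewrite /act /= bmul0l scale1r add0r. Qed.

Lemma actD p q c : act (p + q) c = act p c + act q c.
Proof. by rewrite /act /= bmul_addl scalerDl addrACA. Qed.

Lemma actN p c : act (- p) c = - act p c.
Proof. by rewrite /act /= -[- p.1]scaleN1r bmulZl scaleN1r scaleNr opprD. Qed.

Lemma actB p q c : act (p - q) c = act p c - act q c.
Proof. by rewrite actD actN. Qed.

Lemma actM p q c : act (p * q) c = act p (act q c).
Proof.
rewrite /act /= !(bmul_addl, bmul_addr, bmulZl, bmulZr, scalerDr, scalerA, bmulA).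
by rewrite !addrA [X in X + _](addrAC _ (p.2 *: _)).
Qed.

Lemma act_linear p (k : R[i]) c d : act p (k *: c + d) = k *: act p c + act p d.
Proof.
by rewrite /act bmul_addr bmulZr !scalerDr !scalerA (mulrC k) addrACA.
Qed.

Lemma act_inj a c : act (inj a) c = a ** c.
Proof. by rewrite /act scale0r addr0. Qed.

Lemma act_scal t c : act (scal t) c = t%:C%C *: c.
Proof. by rewrite /act bmul0l add0r. Qed.

Lemma mul_inj p a : p * inj a = inj (act p a).
Proof.
congr (_, _); last by rewrite mulr0.
by rewrite /= scale0r addr0.
Qed.

Lemma injD a b : inj (a + b) = inj a + inj b.
Proof. by congr (_, _); rewrite /= addr0. Qed.

Lemma injN a : inj (- a) = - inj a.
Proof. by congr (_, _); rewrite /= oppr0. Qed.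

Lemma injB a b : inj (a - b) = inj a - inj b.
Proof. by rewrite injD injN. Qed.

Lemma scalD s t : scal (s + t) = scal s + scal t.
Proof. by congr (_, _); rewrite /= ?addr0// rmorphD. Qed.

Lemma scalM s t : scal (s * t) = scal s * scal t.
Proof.
congr (_, _); last by rewrite rmorphM.
by rewrite /= bmul0l !scaler0 !addr0.
Qed.

Lemma scal1 : scal 1 = 1.
Proof. by []. Qed.

Lemma scal0 : scal 0 = 0.
Proof. by []. Qed.

Lemma scalN1 : scal (- 1) = - 1.
Proof. by apply: (addrI (scal 1)); rewrite -scalD subrr scal0 scal1 subrr. Qed.

Lemma scal_half : scal 2^-1 + scal 2^-1 = 1.
Proof. by rewrite -scalD -scal1; congr scal; lra. Qed.

(** * Contractions in the unitization and powers of their means *)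

Definition contr p := forall c, nm (act p c) <= nm c.

Lemma contr1 : contr 1.
Proof. by move=> c; rewrite act1. Qed.

Lemma contrM p q : contr p -> contr q -> contr (p * q).
Proof. by move=> cp cq c; rewrite actM (le_trans (cp _)). Qed.

Lemma contrX p n : contr p -> contr (p ^+ n).
Proof.
move=> cp; elim: n => [|n IH]; first exact: contr1.
by rewrite exprS; exact: contrM.
Qed.

Lemma contr_mean p q : contr p -> contr q -> contr (scal 2^-1 * (p + q)).
Proof.
move=> cp cq c; rewrite actM act_scal nmZr actD ger0_norm ?invr_ge0//.
by have := nmD (act p c) (act q c); have := cp c; have := cq c; lra.
Qed.

(* At a = 0 and n = s ^ 2 this reads |d w^(n-1)| <= 1 / s.  The element bounded
   here is the expectation of (a + S_n) p^i q^(n-i), where S_n = i - (n - i) is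
   a simple random walk, and the bound is that of E|a + S_n| obtained from
   E(a + S_n)^2 = n + a^2; the induction conditions on the first step. *)
Lemma weighted_mean_bound p q d w (s a : R) n c : contr p -> contr q -> 0 < s ->
  d = scal 2^-1 * (p - q) -> w = scal 2^-1 * (p + q) ->
  nm (act (scal n%:R * d * w ^+ n.-1 + scal a * w ^+ n) c) <=
    (s / 2 + (n%:R + a ^+ 2) / (2 * s)) * nm c.
Proof.
move=> cp cq s0 dE wE; elim: n a c => [|n IH] a c.
  have -> : scal 0%:R * d * w ^+ 0.-1 + scal a * w ^+ 0 = scal a.
    by rewrite expr0 !mulr1 scal0 mul0r add0r.
  rewrite act_scal nmZr ler_wpM2r ?nm_ge0// add0r.
  (* With no steps left the claim is the arithmetic-geometric inequality between [s] and the
     absolute value of [a]. *)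
  have := sqr_ge0 (`|a| - s); rewrite sqrrB real_normK ?num_real// => h.
  rewrite -(ler_pM2l (x := 2 * s)) ?mulr_gt0// mulrDr [_ * (_ / (2 * s))]mulrC.
  by rewrite divfK ?mulf_neq0 ?gt_eqF//; lra.
(* At [n = 0] the truncated exponent [n.-1] is harmless, since its coefficient [scal 0] vanishes. *)
have wn : w * (scal n%:R * d * w ^+ n.-1) = scal n%:R * d * w ^+ n.
  case: n {IH} => [|n]; first by rewrite scal0 !mul0r mulr0.
  by rewrite /= exprS; ring.
have h1 := scal_half.
have -> : scal n.+1%:R * d * w ^+ n.+1.-1 + scal a * w ^+ n.+1 =
    scal 2^-1 * (p * (scal n%:R * d * w ^+ n.-1 + scal (a + 1) * w ^+ n) +
                 q * (scal n%:R * d * w ^+ n.-1 + scal (a - 1) * w ^+ n)).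
  have -> : scal 2^-1 * (p * (scal n%:R * d * w ^+ n.-1 + scal (a + 1) * w ^+ n) +
                 q * (scal n%:R * d * w ^+ n.-1 + scal (a - 1) * w ^+ n)) =
     w * (scal n%:R * d * w ^+ n.-1) + (w * scal a + d) * w ^+ n.
    by rewrite !scalD scalN1 scal1 wE dE; ring.
  by rewrite wn -natr1 scalD scal1 /= exprS; ring.
rewrite actM act_scal nmZr ger0_norm ?invr_ge0// actD.
rewrite (@le_trans _ _ (2^-1 * (
   (s / 2 + (n%:R + (a + 1) ^+ 2) / (2 * s)) * nm c +
   (s / 2 + (n%:R + (a - 1) ^+ 2) / (2 * s)) * nm c)))//.
  rewrite ler_pM2l ?invr_gt0// (le_trans (nmD _ _))// !actM.
  by apply: lerD; rewrite ?(le_trans (cp _))// ?(le_trans (cq _)).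
rewrite -mulrDl mulrA ler_wpM2r ?nm_ge0// -natr1.
(* The mean of [(a + 1) ^+ 2] and [(a - 1) ^+ 2] is [a ^+ 2 + 1]: the extra 1 turns [n] into
   [n + 1]. *)
rewrite le_eqVlt; apply/orP; left; apply/eqP; field.
by rewrite gt_eqF.
Qed.

(** Apply the preceding bound with [a = 0], [s = k] and [k ^ 2] steps, where [k > 2 / e]. Half the
    difference contributes at most [1 / k], the difference itself at most [2 / k]. *)
Lemma mean_expn_diff p q (e : R) : contr p -> contr q -> 0 < e -> exists n,
  forall c, nm (act ((p - q) * (scal 2^-1 * (p + q)) ^+ n) c) <= e * nm c.
Proof.
move=> cp cq e0.
have /archimedean.Num.Theory.archi_boundP : 0 <= 2 / e.
  by rewrite divr_ge0// ltW.
set k := archimedean.Num.bound _ => hk.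
have s0 : 0 < k%:R :> R by apply: le_lt_trans hk; rewrite divr_ge0// ltW.
exists (k ^ 2).-1 => c.
have := weighted_mean_bound 0 (k ^ 2) c cp cq s0 erefl erefl; rewrite /= scal0.
rewrite mul0r addr0 -mulrA actM act_scal nmZr ger0_norm// natrX expr0n /= addr0.
set D := act _ _.
have -> : act ((p - q) * (scal 2^-1 * (p + q)) ^+ (k ^ 2).-1) c = 2%:C%C *: D.
  rewrite /D -act_scal -actM; congr act.
  have h : scal 2 * scal 2^-1 = 1 by rewrite -scalM -scal1; congr scal; lra.
  by rewrite -{1}[p - q]mul1r -{1}h; ring.
rewrite nmZr ger0_norm// => h.
have {}h : k%:R * nm D <= nm c.
  rewrite -(ler_pM2l s0) mulrA -expr2 (le_trans h)//.
  rewrite ler_wpM2r ?nm_ge0// le_eqVlt; apply/orP; left; apply/eqP; field.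
  by rewrite gt_eqF.
rewrite -(ler_pM2l s0) mulrCA (le_trans (ler_wpM2l _ h))// mulrA ler_wpM2r ?nm_ge0//.
by move: hk; rewrite ltr_pdivrMr// => /ltW.
Qed.

Lemma bmul_nm a b : nm (a ** b) <= nm a * nm b.
Proof. by rewrite -lecR rmorphM /= -!nmE; exact: bmul_norm. Qed.
End Unitization.

(** * The sets F_A and r_A *)

Section RealPositive.
Set Implicit Arguments.
Unset Strict Implicit.
Variables (R : realType) (V : completeNormedModType R[i]).
Variables (A : banach_alg V) (cA : commutative_alg A).
Local Notation "x ** y" := (bmul A x y) (at level 40).
Local Notation inj := (inj cA).

Lemma net_toP I (D : directed_set I) (u : I -> V) l :
  net_to D u l <-> forall e : R, 0 < e ->
    exists t0, forall t, dle D t0 t -> nm (u t - l) < e.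
Proof.
split=> [ul e e0|ul _ /pos_complexP[e e0 ->]].
  have [|t0 h] := ul (e%:C)%C; first by rewrite ltcR.
  by exists t0 => t /h; rewrite nmE ltcR.
by have [t0 h] := ul e e0; exists t0 => t /h; rewrite nmE ltcR.
Qed.

Lemma net_to_ex I (D : directed_set I) (u : I -> V) l (e : R) :
  net_to D u l -> 0 < e -> exists t, nm (u t - l) < e.
Proof. by move=> /net_toP ul /ul[t0 h]; exists t0; apply: h; exact: dle_refl. Qed.

Lemma approx_unital_ex a (e : R) : approx_unital A -> 0 < e ->
  exists2 u, nm u <= 1 & nm (a ** u - a) < e.
Proof.
move=> [I [D [u [u1 ua]]]] e0; have [t ht] := net_to_ex (ua a).2 e0.
by exists (u t) => //; rewrite -lecR -nmE; exact: u1.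
Qed.

(** Since [a ** u] approximates [a] with [u] in the unit ball, operator bounds on [A] become bounds
    on norms of elements. *)
Lemma approx_unital_nm_le a (r : R) : approx_unital A -> 0 <= r ->
  (forall c, nm (a ** c) <= r * nm c) -> nm a <= r.
Proof.
move=> aA r0 ar; apply/ler_addgt0Pl => e e0.
have [u u1 ua] := approx_unital_ex a aA e0.
have -> : a = a ** u - (a ** u - a) by rewrite subKr.
rewrite (le_trans (nmB _ _))// addrC lerD//; first exact: ltW.
by rewrite (le_trans (ar u))// ler_piMr.
Qed.

(** An identity [e] of norm 1 is itself a test vector, and [a + l e] acts as [a + l 1]. The unital
    and non-unital cases thus merge into one multiplier norm. *)
Lemma unitz_norm_leP a l r :
  unitz_norm_le A a l r <-> forall c, `|c| <= 1 -> `|a ** c + l *: c| <= r.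
Proof.
split=> [[uA nuA] c c1|h]; last first.
  by split=> // _ e [eA e1]; have := h e; rewrite (eA a).2 e1 lexx; exact.
have [[e eA]|/nuA] := pselect (unital A); last exact.
apply: le_trans (uA (ex_intro _ e eA) e eA).
have -> : a ** c + l *: c = (a + l *: e) ** c.
  by rewrite (bmul_addl A) (bmulZl A) (eA.1 c).1.
apply: le_trans (bmul_norm A _ _) _.
by rewrite ler_piMr.
Qed.

Lemma frakFP a : frakF A a <-> contr (1 - inj a).
Proof.
have aE c : - a ** c + 1 *: c = act (1 - inj a) c.
  by rewrite actB act1 act_inj -scaleN1r (bmulZl A) scaleN1r scale1r addrC.
split=> [/unitz_norm_leP aF c|aF].
  have [->|c0] := eqVneq c 0.
    by rewrite -aE (bmul0r cA) scaler0 addr0.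
  have nc0 : nm c != 0 by apply: contra_neq c0; exact: nm_eq0.
  pose k := ((nm c)^-1)%:C%C : R[i].
  have ck : nm (k *: c) = 1 by rewrite nmZr ger0_norm ?invr_ge0 ?nm_ge0// mulVf.
  have := aF (k *: c); rewrite !nmE ck lexx => /(_ isT).
  have a0 : act (1 - inj a) 0 = 0 by rewrite -aE (bmul0r cA) scaler0 addr0.
  rewrite aE -[k *: c]addr0 act_linear a0 addr0 nmZr ger0_norm ?invr_ge0 ?nm_ge0//.
  rewrite (_ : 1 = 1%:C%C)// lecR -ler_pdivlMl ?invrK ?mulr1//.
  by rewrite invr_gt0 lt_neqAle eq_sym nc0 nm_ge0.
apply/unitz_norm_leP => c; rewrite aE !nmE; apply: le_trans.
by rewrite lecR; exact: aF.
Qed.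

(** A state sends [a] into the closed disc of centre 1 and radius 1, which lies in the right
    half-plane. *)
Lemma frakF_sub_frakr : frakF A `<=` frakr A.
Proof.
move=> a aF psi [psilin psile].
have := psile _ _ _ aF; have psi0 : psi 0 = 0.
  have := psilin 1 0 0; rewrite scaler0 addr0 mul1r.
  by move=> /(congr1 (fun z => z - psi 0)); rewrite addrK subrr.
have -> : psi (- a) = - psi a.
  by rewrite -scaleN1r -[-1 *: a]addr0 psilin psi0 addr0 mulN1r.
move=> h; rewrite -complexRe lecR.
have := le_trans (normc_ge_Re _) h; rewrite (_ : 1 = 1%:C%C)// lecR /=.
case: (psi a) => x y /= {}h.
by have := ler_norm (- x + 1); move: h; rewrite /=; lra.
Qed.

(** If [phi] norms [c], then [phi (a ** c)] has nonnegative real part, so [phi] has real part at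
    least [t * nm c] on the vector at the right. *)
Lemma frakr_lower a (t : R) c : frakr A a -> 0 <= t ->
  t * nm c <= nm (a ** c + t%:C%C *: c).
Proof.
move=> ra t0; have [->|c0] := eqVneq c 0; first by rewrite nm0 mulr0 nm_ge0.
have nc0 : nm c != 0 by apply: contra_neq c0; exact: nm_eq0.
have nc_gt0 : 0 < nm c by rewrite lt_neqAle eq_sym nc0 nm_ge0.
pose k := ((nm c)^-1)%:C%C : R[i].
have [phi [philin phile phic]] := norming_functional c.
have kc : `|k *: c| <= 1.
  by rewrite nmE nmZr ger0_norm ?invr_ge0 ?nm_ge0// mulVf.
have kphic : k * phi c = 1 by rewrite phic nmE -rmorphM mulVf.
(* The vector state at [c]; the factor [k] normalizes its value at 1 to [k * phi c = 1]. *)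
pose psi b := k * phi (b ** c).
have psi_state : unitz_state A psi.
  split=> [l x y|b l r /unitz_norm_leP/(_ _ kc)].
    by rewrite /psi (bmulDl A) philin mulrDr mulrCA.
  apply: le_trans.
  have -> : psi b + l = k * phi (l *: c + b ** c).
    by rewrite philin mulrDr mulrCA kphic mulr1 addrC.
  rewrite normrM (bmulZr cA) scalerA (mulrC l) -scalerA -scalerDr normrZ.
  by rewrite ler_wpM2l// addrC.
have := ra _ psi_state; rewrite -complexRe lecR => Re_ge0.
have {}Re_ge0 : 0 <= complex.Re (phi (a ** c)).
  rewrite -(pmulr_rge0 _ (x := (nm c)^-1)) ?invr_gt0//.
  by move: Re_ge0; rewrite /psi /k; case: (phi _) => x y /=; rewrite mul0r subr0.
rewrite -lecR -nmE addrC; apply: le_trans (phile _).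
rewrite philin phic; apply: le_trans (normc_ge_Re _); rewrite lecR nmE.
case: (phi _) Re_ge0 => x y /= x0; rewrite mul0r subr0.
by apply: le_trans (ler_norm _); lra.
Qed.

(* Each halving of [t] perturbs [2 t + x] by [t], which is half of its lower
   bound. *)
Lemma frakr_resolvent_dyadic x n (t : R) b : frakr A x -> 0 < t ->
  2 * nm x <= t * 2 ^+ n -> exists c, x ** c + t%:C%C *: c = b.
Proof.
move=> rx; elim: n t b => [|n IH] t b t0 xt.
  (* For [t >= 2 * nm x] the equation is a fixed-point problem with Lipschitz constant at most
     1/2. *)
  pose f c := (t^-1)%:C%C *: (b - x ** c).
  have [u v|c cE] := @half_contraction_fixpoint _ _ f.
    rewrite /f -scalerBr nmZr ger0_norm ?invr_ge0 ?(ltW t0)//.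
    have -> : b - x ** u - (b - x ** v) = x ** (v - u).
      by rewrite (bmulBr cA) opprB addrC addrA subrK.
    rewrite -(ler_pM2l t0) mulrA mulfV ?gt_eqF// mul1r.
    apply: (le_trans (bmul_nm A _ _)); rewrite (nmBC v) mulrA ler_wpM2r ?nm_ge0//.
    by move: xt; rewrite expr0; lra.
  exists c; rewrite {2}cE /f scalerA -rmorphM mulfV ?gt_eqF// scale1r.
  by rewrite addrC subrK.
have t2 : 0 < 2 * t by rewrite mulr_gt0.
have xt2 : 2 * nm x <= 2 * t * 2 ^+ n by move: xt; rewrite exprS; lra.
(* A fixed point of [f] satisfies [x ** c + 2 t c = b + t c], which is the equation at [t]. *)
have [f fE] := choice (fun c => IH (2 * t) (b + t%:C%C *: c) t2 xt2).
have [u v|c cE] := @half_contraction_fixpoint _ _ f.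
  rewrite -(ler_pM2l t2) (le_trans (frakr_lower (f u - f v) rx (ltW t2)))//.
  have -> : x ** (f u - f v) + (2 * t)%:C%C *: (f u - f v) = t%:C%C *: (u - v).
    rewrite (bmulBr cA) scalerBr addrACA -opprD !fE scalerBr opprD addrACA subrr add0r //.
  by rewrite nmZr gtr0_norm//; lra.
exists c; have := fE c; rewrite -cE mulrDl mul1r rmorphD scalerDl addrA.
by apply: addIr.
Qed.

(** Any [t > 0] is reached by finitely many halvings from a scale of at least [2 * nm x]. *)
Lemma frakr_resolvent x (t : R) b : frakr A x -> 0 < t ->
  exists c, x ** c + t%:C%C *: c = b.
Proof.
move=> rx t0.
have e0 : 0 < t / (2 * nm x + 1).
  by rewrite divr_gt0// ltr_wpDl// mulr_ge0// nm_ge0.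
have [n] := exp_half_lt e0; rewrite ltr_pdivlMr ?ltr_wpDl ?mulr_ge0 ?nm_ge0//.
rewrite exprVn -ltr_pdivlMl ?invr_gt0 ?exprn_gt0// invrK => h.
apply: (@frakr_resolvent_dyadic x n) => //.
by rewrite mulrC in h *; lra.
Qed.

(* [y] is [x (1 + x)^-1]. *)
Lemma frakr_frakF x : frakr A x -> exists2 y, frakF A y & x = y + x ** y.
Proof.
move=> rx; have [y yE] := frakr_resolvent x rx ltr01.
rewrite rmorph1 scale1r in yE.
exists y; last by rewrite addrC.
(* As [1 - y] inverts [1 + x], the lower bound for [1 + x] at [t = 1] is the contractivity of
   [1 - y]. *)
apply/frakFP => c; have := frakr_lower (act (1 - inj y) c) rx ler01.
rewrite mul1r rmorph1 scale1r actB act1 act_inj.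
have xc : x ** c = x ** (y ** c) + y ** c.
  by rewrite (bmulA A) -(bmul_addl A) yE.
have -> // : x ** (c - y ** c) + (c - y ** c) = c.
by rewrite (bmulBr cA) xc [X in X + _]addrAC subrr add0r addrC subrK.
Qed.

Lemma frakF_nm_le a : approx_unital A -> frakF A a -> nm a <= 2.
Proof.
move=> aA /frakFP aF; apply: approx_unital_nm_le => // c.
have := aF c; rewrite actB act1 act_inj => h.
have -> : a ** c = c - (c - a ** c) by rewrite subKr.
by have := nmB c (c - a ** c); lra.
Qed.
End RealPositive.

(** * Ideals *)

Section Ideals.
Set Implicit Arguments.
Unset Strict Implicit.
Variables (R : realType) (V : completeNormedModType R[i]).
Variables (A : banach_alg V) (cA : commutative_alg A).
Implicit Types (S J E : set V).
Local Notation "x ** y" := (bmul A x y) (at level 40).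
Local Notation inj := (inj cA).
Local Notation scal := (scal cA).

Lemma closed_subspace_closure S : S 0 ->
  (forall (k : R[i]) u v, S u -> S v -> S (k *: u + v)) ->
  closed_subspace (closure S).
Proof.
move=> S0 SD; split; [exact: subset_closure| |exact: closed_closure].
move=> k u v /closureP clu /closureP clv; apply/closureP => e e0.
pose m := complex.Re `|k| + 1.
have m0 : 0 < m by rewrite ltr_wpDl// Re_norm_ge0.
have [u' Su' uu'] := clu (e / (2 * m)) (divr_gt0 e0 (mulr_gt0 (ltr0Sn _ 1) m0)).
have [v' Sv' vv'] := clv (e / 2) (divr_gt0 e0 (ltr0Sn _ 1)).
exists (k *: u' + v'); first exact: SD.
have -> : k *: u + v - (k *: u' + v') = k *: (u - u') + (v - v').
  by rewrite scalerBr opprD addrACA.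
rewrite (le_lt_trans (nmD _ _))// nmZ.
have : m * nm (u - u') < e / 2.
  by rewrite -ltr_pdivlMl// mulrC -mulrA -invfM.
by move: (nm_ge0 (u - u')); rewrite /m; lra.
Qed.

Lemma lin_span_linear S (k : R[i]) u v :
  lin_span S u -> lin_span S v -> lin_span S (k *: u + v).
Proof.
move=> [n [c [s [Ss ->]]]] [m [d [t [St ->]]]].
exists (n + m)%N,
  (fun i => match fintype.split i with inl j => k * c j | inr j => d j end),
  (fun i => match fintype.split i with inl j => s j | inr j => t j end); split.
  by move=> i; case: (fintype.split i).
rewrite big_split_ord scaler_sumr; congr (_ + _); apply: eq_bigr => i _.
  by have := unsplitK (inl i : 'I_n + 'I_m); rewrite /= => ->; rewrite scalerA.
by have := unsplitK (inr i : 'I_n + 'I_m); rewrite /= => ->.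
Qed.

Lemma clEA_closed_subspace E : closed_subspace (clEA A E).
Proof.
apply: closed_subspace_closure; last exact: lin_span_linear.
by exists 0%N, (fun=> 0), (fun=> 0); split=> [[]//|]; rewrite big_ord0.
Qed.

(** Works as an induction principle: a property that defines a closed subspace need only be checked
    on products [x ** a]. *)
Lemma clEA_min E S : closed_subspace S ->
  (forall x a, E x -> S (x ** a)) -> clEA A E `<=` S.
Proof.
move=> cS ES; have [_ _ clS] := cS; rewrite /clEA closureE; apply: smallest_sub => //.
move=> _ [n [c [s [Es ->]]]]; apply: closed_subspace_sum => // i.
by apply: closed_subspaceZ => //; have [x [a [Ex ->]]] := Es i; exact: ES.
Qed.

Lemma clEA_gen E x a : E x -> clEA A E (x ** a).
Proof.
move=> Ex; apply: subset_closure; exists 1%N, (fun=> 1), (fun=> x ** a).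
by split=> [_|]; [exists x, a|rewrite big_ord1 scale1r].
Qed.

Lemma act_bounded (p : unitization cA) c :
  nm (act p c) <= (nm p.1 + complex.Re `|p.2 : R[i]|) * nm c.
Proof.
by rewrite mulrDl (le_trans (nmD _ _))// nmZ lerD2r; exact: bmul_nm.
Qed.

Lemma closed_subspace_act (p : unitization cA) S :
  closed_subspace S -> closed_subspace [set v | S (act p v)].
Proof.
move=> [S0 SD clS].
have act0 : act p 0 = 0 by rewrite /act (bmul0r cA) scaler0 addr0.
split=> [|k u v|].
- by rewrite /= act0.
- by rewrite /= act_linear; exact: SD.
apply/closedP => v clv; apply: (iffLR (closedP _) clS) => e e0.
pose m := nm p.1 + complex.Re `|p.2 : R[i]| + 1.
have m0 : 0 < m by rewrite ltr_wpDl// addr_ge0 ?nm_ge0 ?Re_norm_ge0.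
have [u Su uv] := clv (e / m) (divr_gt0 e0 m0); exists (act p u) => //.
have -> : act p v - act p u = act p (v - u).
  by rewrite addrC -scaleN1r -act_linear scaleN1r addrC.
apply: le_lt_trans (act_bounded _ _) _.
move: uv; rewrite ltr_pdivlMr//; have := nm_ge0 (v - u); rewrite /m; lra.
Qed.

Lemma clEA_act E (p : unitization cA) v : clEA A E v -> clEA A E (act p v).
Proof.
apply: (clEA_min (S := [set v | clEA A E (act p v)])).
  exact/closed_subspace_act/clEA_closed_subspace.
move=> x a Ex /=; have -> : act p (x ** a) = x ** act p a.
  by rewrite -!(act_inj cA) -!actM mulrC.
exact: clEA_gen.
Qed.

Lemma clEA_closed_ideal E : is_closed_ideal A (clEA A E).
Proof.
have [? ? ?] := clEA_closed_subspace E; split=> //; split=> //; split=> // x a Ea.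
by rewrite (cA a); split; rewrite -(act_inj cA); exact: clEA_act.
Qed.

Lemma closed_ideal_subspace J : is_closed_ideal A J -> closed_subspace J.
Proof. by move=> [? [? [_ ?]]]. Qed.

Lemma closed_ideal_mul J x a : is_closed_ideal A J -> J x -> J (x ** a).
Proof. by move=> [_ [_ [JM _]]] Jx; case: (JM a x Jx). Qed.

Lemma clEA_sub E J : is_closed_ideal A J -> E `<=` J -> clEA A E `<=` J.
Proof.
move=> iJ EJ; apply: clEA_min; first exact: closed_ideal_subspace.
by move=> x a /EJ; exact: closed_ideal_mul.
Qed.

Lemma clEA_mem E x : approx_unital A -> E x -> clEA A E x.
Proof.
move=> aA Ex; have [_ _ cl] := clEA_closed_subspace E.
apply: (iffLR (closedP _) cl) => e e0; have [u _ ux] := approx_unital_ex x aA e0.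
by exists (x ** u); [exact: clEA_gen|rewrite nmBC].
Qed.

(** The net is indexed by a finite list of vectors together with [n], ordered by inclusion and size,
    with tolerance [1 / (n + 1)] on the list. *)
Lemma has_bai_in_finite J S (M : R) : (forall f, S f -> nm f <= M) ->
  (forall (s : seq V) (e : R), 0 < e -> exists f, [/\ J f, S f &
     forall a, a \in s -> J a -> nm (f ** a - a) < e]) ->
  has_bai_in A J S.
Proof.
move=> SM Jf.
have e0 (i : seq V * nat) : 0 < (i.2.+1%:R)^-1 :> R by rewrite invr_gt0.
have [f fP] := choice (fun i : seq V * nat => Jf i.1 _ (e0 i)).
pose le (i j : seq V * nat) := {subset i.1 <= j.1} /\ (i.2 <= j.2)%N.
have le_refl i : le i i by split.
have le_trans i j k : le i j -> le j k -> le i k.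
  move=> [ij1 ij2] [jk1 jk2]; split; last exact: leq_trans jk2.
  by move=> x /ij1/jk1.
have le_ub i j : exists k, le i k /\ le j k.
  exists (i.1 ++ j.1, maxn i.2 j.2); rewrite /le /= leq_maxl leq_maxr.
  by split; split=> // x; rewrite mem_cat => ->; rewrite ?orbT.
exists _, (DirectedSet le_refl le_trans le_ub (ex_intro _ ([::], 0%N) I)), f.
split=> [i|]; first by have [] := fP i.
split=> [|a Ja].
  by exists (M%:C)%C => i; rewrite nmE lecR; apply: SM; have [] := fP i.
apply/net_toP => e e_gt0.
have /archimedean.Num.Theory.archi_boundP : 0 <= e^-1 by rewrite invr_ge0 ltW.
set n := archimedean.Num.bound _ => hn; exists ([:: a], n) => i [ai ni] /=.
have [_ _ h] := fP i; apply: lt_trans (h a (ai _ (mem_head _ _)) Ja) _.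
rewrite -(invrK e) ltf_pV2 ?posrE ?invr_gt0// (lt_le_trans hn)//.
by rewrite ler_nat (leq_trans ni).
Qed.

Lemma frakF0 : frakF A 0.
Proof. by apply/(frakFP cA) => c; rewrite actB act1 act_inj (bmul0l A) subr0. Qed.

(** The witness [f + g - f ** g] turns products of contractions [1 - f] into elements of the ideal.
    A vector made small by one factor stays small under the other. *)
Lemma frakF_comp J f g : is_closed_ideal A J ->
  J f -> frakF A f -> J g -> frakF A g ->
  exists h, [/\ J h, frakF A h & 1 - inj h = (1 - inj f) * (1 - inj g)].
Proof.
move=> iJ Jf /(frakFP cA) Ff Jg /(frakFP cA) Fg.
have hE : 1 - inj (f + g - f ** g) = (1 - inj f) * (1 - inj g).
  rewrite injB injD -(act_inj cA) -mul_inj; ring.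
exists (f + g - f ** g); split=> //; last by apply/(frakFP cA); rewrite hE; exact: contrM.
have cJ := closed_ideal_subspace iJ.
apply: closed_subspaceB => //; last exact: closed_ideal_mul.
exact: closed_subspaceD.
Qed.

Lemma actBr (p : unitization cA) u v : act p (u - v) = act p u - act p v.
Proof. by rewrite addrC -scaleN1r act_linear scaleN1r addrC. Qed.

(** The vectors [a] that admit such [f] form a closed subspace: sums by [frakF_comp], limits because
    [1 - f] is a contraction. It remains to treat products [x ** b]. *)
Lemma frakF_approx E a (e : R) : approx_unital A -> E `<=` frakF A ->
  clEA A E a -> 0 < e -> exists f,
    [/\ clEA A E f, frakF A f & nm (act (1 - inj f) a) < e].
Proof.
move=> aA EF Ea; move: e; move: Ea; have iE := clEA_closed_ideal E.
apply: (clEA_min (S := [set a | forall e : R, 0 < e -> exists f,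
    [/\ clEA A E f, frakF A f & nm (act (1 - inj f) a) < e]])).
  split.
  - move=> e e0; exists 0; have [E0 _ _] := clEA_closed_subspace E.
    split=> //; first exact: frakF0.
    by rewrite /act (bmul0r cA) scaler0 addr0 nm0.
  - move=> k u v Pu Pv e e0; pose m := complex.Re `|k| + 1.
    have m0 : 0 < m by rewrite ltr_wpDl// Re_norm_ge0.
    have [f [Ef Ff fu]] := Pu (e / (2 * m)) (divr_gt0 e0 (mulr_gt0 (ltr0Sn _ 1) m0)).
    have [g [Eg Fg gv]] := Pv (e / 2) (divr_gt0 e0 (ltr0Sn _ 1)).
    have [h [Eh Fh hE]] := frakF_comp iE Ef Ff Eg Fg; exists h; split=> //.
    rewrite act_linear (le_lt_trans (nmD _ _))// nmZ hE.
    move: Ff Fg => /(frakFP cA) Ff /(frakFP cA) Fg.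
    have := Ff (act (1 - inj g) v); have := Fg (act (1 - inj f) u).
    rewrite -!actM (mulrC (1 - inj g)) => hu hv.
    have : m * nm (act (1 - inj f) u) < e / 2.
      by rewrite -ltr_pdivlMl// mulrC -mulrA -invfM.
    have := ler_wpM2l (Re_norm_ge0 k) hu.
    by have := nm_ge0 (act (1 - inj f) u); rewrite /m; lra.
  - apply/closedP => v clv e e0.
    have [u Pu uv] := clv (e / 2) (divr_gt0 e0 (ltr0Sn _ 1)).
    have [f [Ef Ff fu]] := Pu (e / 2) (divr_gt0 e0 (ltr0Sn _ 1)); exists f; split=> //.
    move: Ff => /(frakFP cA)/(_ (v - u)); rewrite actBr => h.
    rewrite -[act _ v](subrK (act (1 - inj f) u)) (le_lt_trans (nmD _ _))//; lra.
move=> x b Ex e e0; have /(frakFP cA) Fx := EF _ Ex.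
have m0 : 0 < nm b + 1 by rewrite ltr_wpDl// nm_ge0.
(* For the contractions 1 and [1 - x] the difference is [x] and the mean is [w = 1 - x / 2], so
   [x w ^+ n] is small. *)
have [n hn] := mean_expn_diff (contr1 cA) Fx (divr_gt0 e0 m0).
set w := scal 2^-1 * (1 + (1 - inj x)) in hn.
have w1 : 1 - w = scal 2^-1 * inj x.
  by rewrite /w -{1}(scal_half cA); ring.
(* The geometric sum gives [1 - w ^+ n = (x / 2) (1 + w + ... + w ^+ (n - 1))], a multiple of [x]
   and hence in the ideal. *)
pose f := act (scal 2^-1 * \sum_(i < n) w ^+ i) x.
have fE : 1 - inj f = w ^+ n.
  rewrite /f -mul_inj mulrAC -w1 -(opprB w) mulNr opprK -subrX1.
  by rewrite addrC subrK.
exists f; split.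
- exact/clEA_act/clEA_mem.
- by apply/(frakFP cA); rewrite fE; apply/contrX/contr_mean => //; exact: contr1.
have := hn b; rewrite subKr mulrC actM act_inj fE => h; apply: le_lt_trans h _.
rewrite mulrAC ltr_pdivrMr// ltr_pM2l//; lra.
Qed.

(** Vectors of the finite list are treated one at a time, composing the approximants by
    [frakF_comp]; the bound 2 is that of [frakF_nm_le]. *)
Lemma frakF_has_bai E : approx_unital A -> E `<=` frakF A ->
  has_bai_in A (clEA A E) (frakF A).
Proof.
move=> aA EF; have iE := clEA_closed_ideal E.
apply: (has_bai_in_finite (M := 2)) => [f|s e e0]; first exact: frakF_nm_le.
have fE f a : nm (f ** a - a) = nm (act (1 - inj f) a).
  by rewrite actB act1 act_inj nmBC.
elim: s => [|a s [f [Ef Ff fs]]].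
  by exists 0; have [E0 _ _] := clEA_closed_subspace E; split=> //; exact: frakF0.
have [Ea|nEa] := pselect (clEA A E a); last first.
  by exists f; split=> // b; rewrite inE => /predU1P[->//|]; exact: fs.
have [g [Eg Fg ga]] := frakF_approx aA EF Ea e0.
have [h [Eh Fh hE]] := frakF_comp iE Ef Ff Eg Fg; exists h; split=> // b.
move: Ff Fg => /(frakFP cA) Ff /(frakFP cA) Fg.
rewrite inE fE hE => /predU1P[->|bs] Eb.
  by rewrite actM (le_lt_trans (Ff _)).
by rewrite mulrC actM (le_lt_trans (Fg _))// -fE; exact: fs.
Qed.

(** Since [x + y] is [2 z], only the difference [y - x] needs an argument. *)
Lemma frakF_mean_mem x y : approx_unital A -> frakF A x -> frakF A y ->
  let z := act (scal 2^-1) (x + y) in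
  [/\ frakF A z, clEA A [set z] x & clEA A [set z] y].
Proof.
move=> aA /(frakFP cA) Fx /(frakFP cA) Fy z.
pose w := scal 2^-1 * ((1 - inj x) + (1 - inj y)).
have wE : 1 - inj z = w.
  by rewrite /z -mul_inj injD /w -{1}(scal_half cA); ring.
have cz := clEA_closed_subspace [set z]; have [_ _ clz] := cz.
have zz : clEA A [set z] z by exact: clEA_mem.
have xy : clEA A [set z] (y - x).
  apply: (iffLR (closedP _) clz) => e e0.
  have e20 : 0 < e / 2 by rewrite divr_gt0.
  have [n hn] := mean_expn_diff Fx Fy e20.
  (* As [z = 1 - w] in the unitization, [1 - w ^+ n] is a multiple of [z]. The error is
     [w ^+ n (y - x)], whose operator bound becomes a norm bound by [approx_unital_nm_le]. *)
  exists (act (1 - w ^+ n) (y - x)).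
    have -> : 1 - w ^+ n = (\sum_(i < n) w ^+ i) * inj z.
      by rewrite -(subKr 1 (inj z)) wE mulrC -(opprB w) mulNr -subrX1 opprB.
    by rewrite mul_inj act_inj (cA _ (y - x)) -(act_inj cA); do 2!apply: clEA_act.
  rewrite actB act1 subKr; apply: (@le_lt_trans _ _ (e / 2)); last by lra.
  apply: (approx_unital_nm_le aA (ltW e20)) => c.
  rewrite -(act_inj cA) -mul_inj mulrC injB.
  by have := hn c; rewrite opprB addrC addrA subrK /w.
have xpy : clEA A [set z] (x + y).
  have -> : x + y = act (scal 2) z.
    by rewrite /z -actM -scalM (_ : 2 * 2^-1 = 1) ?scal1 ?act1//; lra.
  exact: clEA_act.
have halfE v : act (scal 2^-1) (v + v) = v.
  rewrite act_scal scalerDr -scalerDl -rmorphD (_ : 2^-1 + 2^-1 = 1); last by lra.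
  by rewrite rmorph1 scale1r.
split.
- by apply/(frakFP cA); rewrite wE; exact: contr_mean.
- rewrite -[x]halfE; apply: clEA_act.
  have -> : x + x = (x + y) - (y - x) by rewrite opprB addrA addrAC addrK //.
  exact: (closed_subspaceB cz).
- rewrite -[y]halfE; apply: clEA_act.
  have -> : y + y = (x + y) + (y - x) by rewrite [RHS]addrC addrA subrK.
  exact: (closed_subspaceD cz).
Qed.

(** The family consists of all elements of F_A in the ideal, because [E] itself need not be closed
    under means. It is dense enough: [f ** a] approximates [a] with [f] in the family. *)
Lemma frakF_directed E : approx_unital A -> E `<=` frakF A ->
  directed_union_of A (clEA A E) (frakF A).
Proof.
move=> aA EF; have iE := clEA_closed_ideal E.
have iz z := clEA_closed_ideal [set z].
exists (frakF A `&` clEA A E); split; first exact: subIsetl.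
split; first by exists 0; split; [exact: frakF0|case: iE].
split.
  move=> x y [Fx Ex] [Fy Ey]; have [Fz zx zy] := frakF_mean_mem aA Fx Fy.
  exists (act (scal 2^-1) (x + y)); split.
    split=> //; apply: clEA_act.
    exact: (closed_subspaceD (clEA_closed_subspace E)).
  by split; apply: clEA_sub => // _ ->.
apply/seteqP; split=> [a Ea|].
  apply/closureP => e e0; have [f [Ef Ff fa]] := frakF_approx aA EF Ea e0.
  exists (f ** a); first by exists f => //; exact: clEA_gen.
  by move: fa; rewrite actB act1 act_inj.
have [_ _ clE] := clEA_closed_subspace E.
rewrite closureE; apply: smallest_sub => // a [x [_ Ex] xa].
by move: xa; apply: clEA_sub => // _ ->.
Qed.

(** Directedness makes the union a linear subspace, so its closure is a closed subspace containing
    all products [x ** a]. *)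
Lemma directed_union_clEA J S : directed_union_of A J S ->
  exists2 X, X `<=` S & J = clEA A X.
Proof.
move=> [X [XS [[x0 Xx0] [Xdir ->]]]]; exists X => //.
set B := \bigcup_(x in X) _.
apply/seteqP; split.
  have [_ _ clX] := clEA_closed_subspace X.
  rewrite closureE; apply: smallest_sub => // a [x Xx].
  apply: clEA_min; first exact: clEA_closed_subspace.
  by move=> _ b ->; exact: clEA_gen.
apply: clEA_min => [|x a Xx].
  apply: closed_subspace_closure.
    by exists x0 => //; have [] := clEA_closed_subspace [set x0].
  move=> k u v [x Xx xu] [y Xy yv]; have [z [Xz [xz yz]]] := Xdir x y Xx Xy.
  exists z => //; have [_ + _] := clEA_closed_subspace [set z]; apply.
    exact: xz.
  exact: yz.
by apply: subset_closure; exists x => //; exact: clEA_gen.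
Qed.

(** The approximate identity itself generates: [J] is recovered from its range because [u t ** a]
    tends to [a]. *)
Lemma bai_clEA J S : is_closed_ideal A J -> has_bai_in A J S ->
  exists2 E, E `<=` S & J = clEA A E.
Proof.
move=> iJ [I [D [u [uJS [_ ua]]]]]; exists (range u).
  by move=> _ [t _ <-]; exact: (uJS t).2.
apply/seteqP; split=> [a Ja|]; last first.
  by apply: clEA_sub => // _ [t _ <-]; exact: (uJS t).1.
have [_ _ cl] := clEA_closed_subspace (range u).
apply: (iffLR (closedP _) cl) => e e0; have [t ut] := net_to_ex (ua a Ja) e0.
by exists (u t ** a); [apply: clEA_gen; exists t|rewrite nmBC].
Qed.

(** From [x = y (1 + x)] and [y = x (1 - y)], the elements [x] and [y] have the same products with
    [A]. *)
Lemma clEA_frakr_frakF E : E `<=` frakr A ->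
  exists2 E', E' `<=` frakF A & clEA A E = clEA A E'.
Proof.
move=> Er; pose E' := [set y | frakF A y /\ exists2 x, E x & x = y + x ** y].
exists E'; first by move=> y [].
have sub x y a : x = y + x ** y -> x ** a = y ** (a + x ** a).
  move=> xE; rewrite (bmul_addr A) {1}xE (bmul_addl A) (bmulA A).
  by rewrite (cA y x).
have sub' x y a : x = y + x ** y -> y ** a = x ** (a - y ** a).
  by move=> xE; rewrite (bmulBr cA) (bmulA A) {1}xE (bmul_addl A) addrK.
apply/seteqP; split; apply: clEA_min; try exact: clEA_closed_subspace.
  move=> x a Ex; have [y Fy xE] := frakr_frakF cA (Er _ Ex).
  by rewrite (sub _ y a xE); apply: clEA_gen; split=> //; exists x.
by move=> y a [_ [x Ex xE]]; rewrite (sub' x y a xE); exact: clEA_gen.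
Qed.

End Ideals.

(** * Equivalence of approximate identities, generating sets and directed unions *)

Theorem theorem7p1 (R : realType) (V : completeNormedModType R[i])
    (A : banach_alg V) :
  commutative_alg A -> approx_unital A ->
  forall J : set V,
    ((is_closed_ideal A J /\ has_bai_in A J (frakr A)) <->
       (exists E, E `<=` frakF A /\ J = clEA A E)) /\
    ((is_closed_ideal A J /\ has_bai_in A J (frakF A)) <->
       (exists E, E `<=` frakr A /\ J = clEA A E)) /\
    ((is_closed_ideal A J /\ has_bai_in A J (frakr A)) <->
       directed_union_of A J (frakF A)) /\
    ((is_closed_ideal A J /\ has_bai_in A J (frakF A)) <->
       directed_union_of A J (frakr A)).
Proof.
move=> cA aA J.
have Fr := @frakF_sub_frakr _ _ A.
(* [EF] is the hub: each condition, even in its r_A form, implies it; it yields the F_A forms, and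
   the inclusion of F_A in r_A gives the rest. *)
pose EF := exists2 E, E `<=` frakF A & J = clEA A E.
pose Er := exists2 E, E `<=` frakr A & J = clEA A E.
have ErF : Er -> EF.
  by move=> [E /(clEA_frakr_frakF cA)[E' E'F EE'] JE]; exists E'; rewrite // JE.
have baiFr : has_bai_in A J (frakF A) -> has_bai_in A J (frakr A).
  move=> [I [D [u [uJF uM]]]]; exists I, D, u; split=> // t.
  by have [? /Fr] := uJF t.
have EF_bai : EF -> is_closed_ideal A J /\ has_bai_in A J (frakF A).
  by move=> [E EF_ ->]; split; [exact: clEA_closed_ideal|exact: frakF_has_bai].
have EF_dir : EF -> directed_union_of A J (frakF A).
  by move=> [E EF_ ->]; exact: frakF_directed.
have dirFr : directed_union_of A J (frakF A) -> directed_union_of A J (frakr A).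
  by move=> [X [XF XP]]; exists X; split=> // x /XF/Fr.
have bai_EF : is_closed_ideal A J /\ has_bai_in A J (frakr A) -> EF.
  by move=> [iJ baiJ]; apply: ErF; exact: (bai_clEA iJ baiJ).
have dir_EF : directed_union_of A J (frakr A) -> EF.
  by move=> dJ; apply: ErF; exact: (directed_union_clEA dJ).
split; [split|split; [split|split; split]].
- by move=> /bai_EF[E ? ?]; exists E.
- by move=> [E [EF_ JE]]; have /EF_bai[? /baiFr] : EF by exists E.
- move=> [iJ /baiFr baiJ]; have [E EF_ JE] := bai_EF (conj iJ baiJ).
  by exists E; split=> // x /EF_/Fr.
- by move=> [E [Er_ JE]]; apply/EF_bai/ErF; exists E.
- by move=> /bai_EF/EF_dir.
- by move=> /dirFr/dir_EF/EF_bai[? /baiFr].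
- by move=> [iJ /baiFr baiJ]; exact/dirFr/EF_dir/bai_EF.
- by move=> /dir_EF/EF_bai.
Qed.
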